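(* The functor $\mathbf{C}\colon \mathbf{Bool} \to \mathbf{augStone}$ is left adjoint to the functor $\mathrm{Clos}\colon \mathbf{augStone} \to \mathbf{Bool}$.
   Context: A Stone algebra is a Heyting algebra $S$ satisfying $\neg x \lor \neg\neg x = 1_S$ for all $x\in S$, where $\neg x = x \to 0$. The closure of $x$ is $\mathrm{Clos}(x) = \neg\neg x$, and $x$ is closed if $\mathrm{Clos}(x)=x$. An augmented Stone algebra is a tuple $(S,\land,\lor,\to,1,0,e)$ such that $(S,\land,\lor,\to,1,0)$ is a Stone algebra and $e\in S$ (the closure element) satisfies $e\to x = \neg\neg x$ for all $x\in S$. $\mathbf{augStone}$ is the category of augmented Stone algebras; its morphisms are the maps preserving $\land,\lor,\to,1,0$ and $e$. $\mathbf{Bool}$ is the category of Boolean algebras and Boolean homomorphisms. The functor $\mathrm{Clos}\colon \mathbf{augStone}\to\mathbf{Bool}$ sends $S$ to its Boolean algebra of closed elements (with operations inherited from $S$) and sends a morphism to its restriction to closed elements. The contract functor $\mathbf{C}\colon\mathbf{Bool}\to\mathbf{augStone}$ sends a Boolean algebra $B$ to $\mathbf{C}(B)=\{(a,g)\in B^2 : a\lor g = 1_B\}$ with operations $(a,g)\land(a',g') = (a\lor a', g\land g')$, $(a,g)\lor(a',g') = (a\land a', g\lor g')$, $(a',g')\to(a,g) = ((a\land\neg a')\lor(g'\land\neg g), \neg g'\lor g)$, top $1=(0_B,1_B)$, bottom $0=(1_B,0_B)$, and closure element $e=(1_B,1_B)$. It sends a Boolean homomorphism $f\colon B\to B'$ to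 $\mathbf{C}(f)(a,g)=(f(a),f(g))$. *)

(* Defs.v *)
From HB Require Import structures.
From mathcomp Require Import all_boot all_order.
From mathcomp Require Import boolp.

Set Implicit Arguments.
Unset Strict Implicit.
Unset Printing Implicit Defensive.

Import Order.Theory.
Local Open Scope order_scope.

(* Distributivity is redundant here, since it follows from the adjunction
   [le_himp]; it is kept in the parent structure to inherit the theory of
   [tbDistrLatticeType]. *)
HB.mixin Record hasHeytingImp (d : Order.disp_t) T
    of Order.TBDistrLattice d T := {
  himp : T -> T -> T;
  le_himp : forall x y z : T, (z <= himp x y) = (z `&` x <= y)
}.

#[short(type="heytingType")]
HB.structure Definition Heyting (d : Order.disp_t) :=
  { T of Order.TBDistrLattice d T & hasHeytingImp d T }.

Definition hneg (d : Order.disp_t) (T : heytingType d) (x : T) : T :=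
  himp x \bot.

Definition clos (d : Order.disp_t) (T : heytingType d) (x : T) : T :=
  hneg (hneg x).

HB.mixin Record Heyting_isStone (d : Order.disp_t) T of Heyting d T := {
  stone_axiom : forall x : T, hneg x `|` hneg (hneg x) = \top
}.

#[short(type="stoneType")]
HB.structure Definition Stone (d : Order.disp_t) :=
  { T of Heyting d T & Heyting_isStone d T }.

HB.mixin Record Stone_isAugmented (d : Order.disp_t) T of Stone d T := {
  closure_elt : T;
  closure_eltE : forall x : T, himp closure_elt x = hneg (hneg x)
}.

#[short(type="augStoneType")]
HB.structure Definition AugStone (d : Order.disp_t) :=
  { T of Stone d T & Stone_isAugmented d T }.

Section HeytingTheory.
Context {d : Order.disp_t} {T : heytingType d}.
Implicit Types x y z : T.

Lemma le_hneg x z : (z <= hneg x) = (z `&` x == \bot).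
Proof. by rewrite le_himp lex0. Qed.

Lemma meet_hneg x : x `&` hneg x = \bot.
Proof. by apply/eqP; rewrite meetC -le_hneg. Qed.

Lemma hnegS x y : x <= y -> hneg y <= hneg x.
Proof.
move=> xy; rewrite le_hneg -lex0 -(meet_hneg y) meetC.
by rewrite leI2.
Qed.

Lemma le_clos x : x <= clos x.
Proof. by rewrite /clos le_hneg meet_hneg. Qed.

Lemma closS x y : x <= y -> clos x <= clos y.
Proof. by move=> xy; do 2!apply: hnegS. Qed.

Lemma hneg_closed x : clos (hneg x) = hneg x.
Proof. by apply/eqP; rewrite eq_le le_clos hnegS ?le_clos. Qed.

Lemma hneg_top : hneg \top = \bot :> T.
Proof. by rewrite -(meet_hneg \top) meet1x. Qed.

Lemma hneg_bot : hneg \bot = \top :> T.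
Proof. by apply/eqP; rewrite -le1x le_hneg meetx0. Qed.

Lemma hnegU x y : hneg (x `|` y) = hneg x `&` hneg y.
Proof.
apply/eqP; rewrite eq_le lexI !hnegS ?leUl ?leUr //=.
rewrite le_hneg meetUr [X in X `|` _]meetAC -[X in _ `|` X]meetA.
by rewrite ![hneg _ `&` _]meetC !meet_hneg meet0x meet0x joinx0.
Qed.

Lemma clos_idem x : clos (clos x) = clos x.
Proof. exact: hneg_closed. Qed.

Lemma closI x y : clos x = x -> clos y = y -> clos (x `&` y) = x `&` y.
Proof.
move=> cx cy; apply/eqP; rewrite eq_le le_clos andbT lexI.
by rewrite -[X in _ <= X]cx closS ?leIl //= -[X in _ <= X]cy closS ?leIr.
Qed.

End HeytingTheory.

Section StoneTheory.
Context {d : Order.disp_t} {T : stoneType d}.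
Implicit Types x y z : T.

Lemma hnegI_stone x y : hneg (x `&` y) = hneg x `|` hneg y.
Proof.
apply/eqP; rewrite eq_le leUx !hnegS ?leIl ?leIr // andbT.
rewrite -[leLHS]meetx1 -(stone_axiom x) meetUr leUx.
rewrite (le_trans (leIr _ _)) ?leUl //= (@le_trans _ _ (hneg y)) ?leUr //.
have h : hneg (x `&` y) `&` y <= hneg x.
  by rewrite le_hneg -meetA [y `&` x]meetC meetC meet_hneg.
by rewrite le_hneg meetAC -lex0 -(meet_hneg (hneg x)) leI2.
Qed.

Lemma closU x y : clos x = x -> clos y = y -> clos (x `|` y) = x `|` y.
Proof. by move=> cx cy; rewrite /clos hnegU hnegI_stone -!/(clos _) cx cy. Qed.

End StoneTheory.

Definition is_closed (d : Order.disp_t) (S : stoneType d) : pred S :=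
  [pred x | clos x == x].

Record closed (d : Order.disp_t) (S : stoneType d) : Type := Closed {
  closed_val : S;
  closed_valP : is_closed closed_val
}.

HB.instance Definition _ (d : Order.disp_t) (S : stoneType d) :=
  [isSub of closed S for @closed_val d S].
HB.instance Definition _ (d : Order.disp_t) (S : stoneType d) :=
  [Choice of closed S by <:].

Section ClosedBool.
Context {d : Order.disp_t} {S : stoneType d}.

Fact is_closedI (x y : S) :
  is_closed x -> is_closed y -> is_closed (x `&` y).
Proof. by move=> /eqP cx /eqP cy; apply/eqP; apply: closI. Qed.

Fact is_closedU (x y : S) :
  is_closed x -> is_closed y -> is_closed (x `|` y).
Proof. by move=> /eqP cx /eqP cy; apply/eqP; apply: closU. Qed.

Fact is_closed0 : is_closed (\bot : S).
Proof. by apply/eqP; rewrite /clos hneg_bot hneg_top. Qed.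

Fact is_closed1 : is_closed (\top : S).
Proof. by apply/eqP; rewrite /clos hneg_top hneg_bot. Qed.

Fact is_closedN (x : S) : is_closed (hneg x).
Proof. by apply/eqP; apply: hneg_closed. Qed.

HB.instance Definition _ := Order.SubChoice_isTBSubLattice.Build
  d S (@is_closed d S) d (closed S)
  is_closedI is_closedU is_closed0 is_closed1.

Fact closed_meetUl : @left_distributive (closed S) _ Order.meet Order.join.
Proof. by move=> x y z; apply: val_inj; rewrite /= meetUl. Qed.

HB.instance Definition _ :=
  Order.Lattice_Meet_isDistrLattice.Build d (closed S) closed_meetUl.

Definition closed_neg (x : closed S) : closed S :=
  Closed (is_closedN (closed_val x)).

Fact closed_joinxN (x : closed S) : x `|` closed_neg x = \top.
Proof.
apply: val_inj => /=; case: x => x /= /eqP cx.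
by rewrite -[X in X `|` _]cx joinC; apply: stone_axiom.
Qed.

Fact closed_meetxN (x : closed S) : x `&` closed_neg x = \bot.
Proof. by apply: val_inj; apply: meet_hneg. Qed.

HB.instance Definition _ := Order.TBDistrLattice_hasComplement.Build
  d (closed S) closed_joinxN closed_meetxN.

End ClosedBool.

(* A pair [(a, g)] is an assumption and a guarantee; the order is reversed on
   assumptions. *)
Record contract (d : Order.disp_t) (B : ctbDistrLatticeType d) : Type :=
  Contract {
    contract_val : B * B;
    contract_valP : contract_val.1 `|` contract_val.2 == \top
  }.

HB.instance Definition _ (d : Order.disp_t) (B : ctbDistrLatticeType d) :=
  [isSub of contract B for @contract_val d B].
HB.instance Definition _ (d : Order.disp_t) (B : ctbDistrLatticeType d) :=
  [Choice of contract B by <:].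

Section ContractAlgebra.
Context {d : Order.disp_t} {B : ctbDistrLatticeType d}.
Implicit Types x y z : contract B.

Local Notation asm x := (contract_val x).1.
Local Notation gua x := (contract_val x).2.

Fact asm_gua x : asm x `|` gua x = \top.
Proof. exact/eqP/contract_valP. Qed.

Fact contract_meet_subproof x y :
  (asm x `|` asm y) `|` (gua x `&` gua y) == \top.
Proof.
rewrite joinIr [asm x `|` _ `|` gua x]joinAC asm_gua join1x meet1x.
by rewrite -joinA asm_gua joinx1.
Qed.

Fact contract_join_subproof x y :
  (asm x `&` asm y) `|` (gua x `|` gua y) == \top.
Proof.
rewrite joinIl [asm y `|` _]joinCA asm_gua joinx1 meetx1.
by rewrite joinA asm_gua join1x.
Qed.

Fact contract_imp_subproof x y :
  ((asm y `&` ~` asm x) `|` (gua x `&` ~` gua y)) `|` (~` gua x `|` gua y)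
    == \top.
Proof.
have -> : gua x `&` ~` gua y = ~` (~` gua x `|` gua y).
  by rewrite complU complK.
by rewrite -joinA joinCx joinx1.
Qed.

Definition contract_meet x y : contract B :=
  @Contract d B (asm x `|` asm y, gua x `&` gua y) (contract_meet_subproof x y).

Definition contract_join x y : contract B :=
  @Contract d B (asm x `&` asm y, gua x `|` gua y) (contract_join_subproof x y).

Definition contract_imp x y : contract B :=
  @Contract d B
    ((asm y `&` ~` asm x) `|` (gua x `&` ~` gua y), ~` gua x `|` gua y)
    (contract_imp_subproof x y).

Definition contract_top : contract B :=
  @Contract d B (\bot, \top) (introT eqP (joinx1 _)).

Definition contract_bot : contract B :=
  @Contract d B (\top, \bot) (introT eqP (join1x _)).

Definition contract_e : contract B :=
  @Contract d B (\top, \top) (introT eqP (join1x _)).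

Definition contract_le x y : bool := contract_meet x y == x.
Definition contract_lt x y : bool := (y != x) && contract_le x y.

Fact contract_leE x y :
  contract_le x y = (asm y <= asm x) && (gua x <= gua y).
Proof.
rewrite /contract_le -val_eqE /=; case: (contract_val x) => a g.
by rewrite xpair_eqE eq_joinl eq_meetl.
Qed.

Fact contract_meetC : commutative contract_meet.
Proof. by move=> x y; apply: val_inj; rewrite /= joinC meetC. Qed.

Fact contract_joinC : commutative contract_join.
Proof. by move=> x y; apply: val_inj; rewrite /= joinC meetC. Qed.

Fact contract_meetA : associative contract_meet.
Proof. by move=> x y z; apply: val_inj; rewrite /= joinA meetA. Qed.

Fact contract_joinA : associative contract_join.
Proof. by move=> x y z; apply: val_inj; rewrite /= joinA meetA. Qed.

Fact contract_joinKI y x : contract_meet x (contract_join x y) = x.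
Proof. by apply: val_inj; rewrite /= meetKU joinKI -surjective_pairing. Qed.

Fact contract_meetKU y x : contract_join x (contract_meet x y) = x.
Proof. by apply: val_inj; rewrite /= meetKU joinKI -surjective_pairing. Qed.

Fact contract_meetUl : left_distributive contract_meet contract_join.
Proof.
by move=> x y z; apply: val_inj; congr (_, _); [exact: joinIl | exact: meetUl].
Qed.

Fact contract_meetxx : idempotent_op contract_meet.
Proof.
by move=> x; apply: val_inj; rewrite /= joinxx meetxx -surjective_pairing.
Qed.

HB.instance Definition _ := Order.isMeetJoinDistrLattice.Build d (contract B)
  (fun _ _ => erefl) (fun _ _ => erefl)
  contract_meetC contract_joinC contract_meetA contract_joinA
  contract_joinKI contract_meetKU contract_meetUl contract_meetxx.

Fact contract_le0x x : contract_bot <= x.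
Proof. by rewrite [_ <= _]contract_leE /= lex1 le0x. Qed.

Fact contract_lex1 x : x <= contract_top.
Proof. by rewrite [_ <= _]contract_leE /= lex1 le0x. Qed.

HB.instance Definition _ :=
  Order.hasBottom.Build d (contract B) contract_le0x.
HB.instance Definition _ :=
  Order.hasTop.Build d (contract B) contract_lex1.

Fact contract_le_imp x y z : (z <= contract_imp x y) = (z `&` x <= y).
Proof.
rewrite [LHS]contract_leE [RHS]contract_leE /= leUx -!diffE leBLR.
rewrite [asm x `|` _]joinC.
have -> : (gua z <= ~` gua x `|` gua y) = (gua z `&` gua x <= gua y).
  by rewrite -leBLR diffE complK.
have [h|_] := boolP (gua z `&` _ <= _); last by rewrite !andbF.
rewrite !andbT; apply: andb_idr => _.
rewrite leBLR -[leLHS]meetx1 -(asm_gua z) meetUr leUx.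
apply/andP; split; first exact: le_trans (leIr _ _) (leUr _ _).
by rewrite meetC; apply: le_trans h (leUl _ _).
Qed.

HB.instance Definition _ :=
  hasHeytingImp.Build d (contract B) contract_le_imp.

(* [~ (a, g) = (g, ~ g)], using [a \/ g = 1]. *)
Fact contract_hnegE x : contract_val (hneg x) = (gua x, ~` gua x).
Proof.
rewrite /hneg /himp /= meet1x compl0 meetx1 joinx0; congr (_, _).
by apply/join_r; rewrite -[X in X <= _]meetx1 -(asm_gua x) meetUr meetCx
  join0x leIr.
Qed.

Fact contract_stone x : hneg x `|` hneg (hneg x) = \top.
Proof.
apply: val_inj; rewrite -[LHS]/(asm (hneg x) `&` asm (hneg (hneg x)),
  gua (hneg x) `|` gua (hneg (hneg x))) !contract_hnegE /=.
by rewrite meetxC joinxC.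
Qed.

HB.instance Definition _ := Heyting_isStone.Build d (contract B) contract_stone.

Fact contract_eE x : himp contract_e x = hneg (hneg x).
Proof.
apply: val_inj; rewrite [RHS]contract_hnegE contract_hnegE /=.
by rewrite compl1 meetx0 meet1x !join0x complK.
Qed.

HB.instance Definition _ :=
  Stone_isAugmented.Build d (contract B) contract_eE.

End ContractAlgebra.

(* The library's [{tblmorphism _ -> _}] only preserves [\bot]
   and [\top], hence the explicit lists of preserved operations. *)

Record is_bool_hom (d d' : Order.disp_t) (B : ctbDistrLatticeType d)
    (B' : ctbDistrLatticeType d') (f : B -> B') : Prop := IsBoolHom {
  bool_homI : forall x y, f (x `&` y) = f x `&` f y;
  bool_homU : forall x y, f (x `|` y) = f x `|` f y;
  bool_homC : forall x, f (~` x) = ~` f x;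
  bool_hom1 : f \top = \top;
  bool_hom0 : f \bot = \bot
}.

Record bool_hom (d d' : Order.disp_t) (B : ctbDistrLatticeType d)
    (B' : ctbDistrLatticeType d') : Type := BoolHom {
  bool_fun :> B -> B';
  bool_funP : is_bool_hom bool_fun
}.

Record is_aug_hom (d d' : Order.disp_t) (S : augStoneType d)
    (S' : augStoneType d') (f : S -> S') : Prop := IsAugHom {
  aug_homI : forall x y, f (x `&` y) = f x `&` f y;
  aug_homU : forall x y, f (x `|` y) = f x `|` f y;
  aug_homimp : forall x y, f (himp x y) = himp (f x) (f y);
  aug_hom1 : f \top = \top;
  aug_hom0 : f \bot = \bot;
  aug_home : f closure_elt = closure_elt
}.

Record aug_hom (d d' : Order.disp_t) (S : augStoneType d)
    (S' : augStoneType d') : Type := AugHom {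
  aug_fun :> S -> S';
  aug_funP : is_aug_hom aug_fun
}.

Lemma bool_hom_ext (d d' : Order.disp_t) (B : ctbDistrLatticeType d)
  (B' : ctbDistrLatticeType d') (f g : bool_hom B B') : f =1 g -> f = g.
Proof.
case: f g => [f fP] [g gP] /= /funext fg; case: _ / fg in gP *.
by congr BoolHom; apply: Prop_irrelevance.
Qed.

Lemma aug_hom_ext (d d' : Order.disp_t) (S : augStoneType d)
  (S' : augStoneType d') (f g : aug_hom S S') : f =1 g -> f = g.
Proof.
case: f g => [f fP] [g gP] /= /funext fg; case: _ / fg in gP *.
by congr AugHom; apply: Prop_irrelevance.
Qed.

Record category : Type := Category {
  ob : Type;
  hom : ob -> ob -> Type;
  idm : forall X, hom X X;
  comp : forall X Y Z, hom Y Z -> hom X Y -> hom X Z;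
  comp_idl : forall X Y (f : hom X Y), comp (idm Y) f = f;
  comp_idr : forall X Y (f : hom X Y), comp f (idm X) = f;
  comp_assoc : forall X Y Z W (h : hom Z W) (g : hom Y Z) (f : hom X Y),
    comp h (comp g f) = comp (comp h g) f
}.

Record functor (C D : category) : Type := Functor {
  fob :> ob C -> ob D;
  fmap : forall X Y : ob C, hom X Y -> hom (fob X) (fob Y);
  fmap_id : forall X, fmap (idm X) = idm (fob X);
  fmap_comp : forall X Y Z (g : hom Y Z) (f : hom X Y),
    fmap (comp g f) = comp (fmap g) (fmap f)
}.

(* [F] is left adjoint to [G]: there is a bijection
   [hom (F X) Y ~ hom X (G Y)] natural in both [X] and [Y]. *)
Definition left_adjoint (C D : category)
    (F : functor C D) (G : functor D C) : Prop :=
  exists phi : forall (X : ob C) (Y : ob D), hom (F X) Y -> hom X (G Y),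
    [/\ forall X Y, bijective (@phi X Y),
        forall (X X' : ob C) (Y : ob D) (u : hom X' X) (f : hom (F X) Y),
          phi X' Y (comp f (fmap F u)) = comp (phi X Y f) u
      & forall (X : ob C) (Y Y' : ob D) (v : hom Y Y') (f : hom (F X) Y),
          phi X Y' (comp v f) = comp (fmap G v) (phi X Y f)].

(* The order library puts its structures on choice types; homomorphisms ignore
   the choice operator. *)
Section BoolCategory.
Context (d : Order.disp_t).
Implicit Types A B C : ctbDistrLatticeType d.

Fact bool_id_subproof A : is_bool_hom (@id A).
Proof. by split. Qed.

Definition bool_id A : bool_hom A A := BoolHom (bool_id_subproof A).

Fact bool_comp_subproof A B C (g : bool_hom B C) (f : bool_hom A B) :
  is_bool_hom (g \o f).
Proof.
by case: f g => [f [fI fU fC f1 f0]] [g [gI gU gC g1 g0]]; split=> * /=;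
  rewrite ?(fI, fU, fC, f1, f0, gI, gU, gC, g1, g0).
Qed.

Definition bool_comp A B C (g : bool_hom B C) (f : bool_hom A B) :
  bool_hom A C := BoolHom (bool_comp_subproof g f).

Definition BoolCat : category.
Proof.
refine (@Category (ctbDistrLatticeType d) (fun A B => bool_hom A B)
  bool_id bool_comp _ _ _); by move=> *; apply: bool_hom_ext.
Defined.

End BoolCategory.

Section AugStoneCategory.
Context (d : Order.disp_t).
Implicit Types R S T : augStoneType d.

Fact aug_id_subproof S : is_aug_hom (@id S).
Proof. by split. Qed.

Definition aug_id S : aug_hom S S := AugHom (aug_id_subproof S).

Fact aug_comp_subproof R S T (g : aug_hom S T) (f : aug_hom R S) :
  is_aug_hom (g \o f).
Proof.
by case: f g => [f [fI fU fi f1 f0 fe]] [g [gI gU gi g1 g0 ge]];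
  split=> * /=; rewrite ?(fI, fU, fi, f1, f0, fe, gI, gU, gi, g1, g0, ge).
Qed.

Definition aug_comp R S T (g : aug_hom S T) (f : aug_hom R S) :
  aug_hom R T := AugHom (aug_comp_subproof g f).

Definition AugStoneCat : category.
Proof.
refine (@Category (augStoneType d) (fun S T => aug_hom S T)
  aug_id aug_comp _ _ _); by move=> *; apply: aug_hom_ext.
Defined.

End AugStoneCategory.

Section ClosFunctor.
Context {d : Order.disp_t}.

Lemma aug_hom_hneg (S T : augStoneType d) (f : aug_hom S T) x :
  f (hneg x) = hneg (f x).
Proof. by rewrite /hneg (aug_homimp (aug_funP f)) (aug_hom0 (aug_funP f)). Qed.

Fact clos_fun_subproof (S T : augStoneType d) (f : aug_hom S T)
  (x : closed S) : is_closed (f (closed_val x)).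
Proof.
by apply/eqP; rewrite /clos -!aug_hom_hneg; congr (f _); apply/eqP/closed_valP.
Qed.

Definition clos_fun (S T : augStoneType d) (f : aug_hom S T)
  (x : closed S) : closed T := Closed (clos_fun_subproof f x).

Fact clos_hom_subproof (S T : augStoneType d) (f : aug_hom S T) :
  is_bool_hom (clos_fun f).
Proof.
split=> [x y|x y|x||]; apply: val_inj => /=.
- exact: (aug_homI (aug_funP f)).
- exact: (aug_homU (aug_funP f)).
- exact: aug_hom_hneg.
- exact: (aug_hom1 (aug_funP f)).
- exact: (aug_hom0 (aug_funP f)).
Qed.

Definition clos_hom (S T : augStoneType d) (f : aug_hom S T) :
  bool_hom (closed S) (closed T) := BoolHom (clos_hom_subproof f).

End ClosFunctor.

Definition ClosFunctor (d : Order.disp_t) :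
  functor (AugStoneCat d) (BoolCat d).
Proof.
refine (@Functor (AugStoneCat d) (BoolCat d) (fun S => closed S)
  (@clos_hom d) _ _).
- by move=> S; apply: bool_hom_ext => x; apply: val_inj.
- by move=> R S T g f; apply: bool_hom_ext => x; apply: val_inj.
Defined.

Section ContractFunctor.
Context {d : Order.disp_t}.

Fact contract_fun_subproof (B B' : ctbDistrLatticeType d)
  (f : bool_hom B B') (x : contract B) :
  f (contract_val x).1 `|` f (contract_val x).2 == \top.
Proof.
by rewrite -(bool_homU (bool_funP f)) asm_gua (bool_hom1 (bool_funP f)).
Qed.

Definition contract_fun (B B' : ctbDistrLatticeType d)
  (f : bool_hom B B') (x : contract B) : contract B' :=
  @Contract d B' (f (contract_val x).1, f (contract_val x).2)
    (contract_fun_subproof f x).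

Fact contract_hom_subproof (B B' : ctbDistrLatticeType d)
  (f : bool_hom B B') : is_aug_hom (contract_fun f).
Proof.
case: (bool_funP f) => fI fU fC f1 f0.
by split=> *; apply: val_inj; rewrite /= ?(fI, fU, fC, f1, f0).
Qed.

Definition contract_hom (B B' : ctbDistrLatticeType d)
  (f : bool_hom B B') : aug_hom (contract B) (contract B') :=
  AugHom (contract_hom_subproof f).

End ContractFunctor.

Definition ContractFunctor (d : Order.disp_t) :
  functor (BoolCat d) (AugStoneCat d).
Proof.
refine (@Functor (BoolCat d) (AugStoneCat d) (fun B => contract B)
  (@contract_hom d) _ _).
- move=> B; apply: aug_hom_ext => x; apply: val_inj => /=.
  by rewrite -surjective_pairing.
- by move=> A B C g f; apply: aug_hom_ext => x; apply: val_inj.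
Defined.

(* Main.v *)
From mathcomp Require Import all_boot all_order.
Require Import Defs.

(** The contract algebra over [B] is free on [B] because a contract is built
    from closed elements and [e] alone.  The closed contracts are the pairs
    [(~ b, b)], so [b |-> (~ b, b)] embeds [B] onto them (the unit
    [adj_unit] of the adjunction), and every contract decomposes as
      [(a, g) = (~ g, g) /\ ((a, ~ a) \/ e)]     ([contract_decomp]).
    A morphism out of [C(B)] is therefore determined by its values on closed
    elements, and a Boolean homomorphism [h : B -> Clos(S)] can only extend to
      [(a, g) |-> h g /\ (~ h a \/ e)].

    What has to be checked is that this extension ([mate]) is a morphism.
    Everything happens in [S], where [realize c b = b /\ (~ c \/ e)] for closed
    [c] and [b] with [c \/ b = 1].  That condition gives [~ c <= b], so
    [realize c b] is also [~ c \/ (b /\ e)]: the first form shows that meets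
    are preserved, the second that joins are.  Implication ([realize_imp])
    rests on two facts.  A closed element of a Stone algebra is complemented, so
    an implication out of it is [c -> x = ~ c \/ x] ([himp_closed]); and
    [e -> x = ~~ x], where [e] itself is dense, so that [e -> realize c b = b]
    ([himp_closure_eltI]).  No other premises occur once [realize c b] is split
    along its meets and joins.

    The bijection on hom-sets is [f |-> (b |-> f (~ b, b))], and its naturality
    can be read off this formula. *)

Set Implicit Arguments.
Unset Strict Implicit.
Unset Printing Implicit Defensive.

Import Order.Theory.
Local Open Scope order_scope.

Section Heyting.
Context {d : Order.disp_t} {T : heytingType d}.
Implicit Types x y z : T.

Lemma le_himp_antisym x y : (forall z, (z <= x) = (z <= y)) -> x = y.
Proof. by move=> xy; apply/le_anti; rewrite -xy lexx xy lexx. Qed.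

Lemma himpxx x : himp x x = \top.
Proof. by apply/eqP; rewrite -le1x le_himp meet1x. Qed.

Lemma himpIl x y z : himp (x `&` y) z = himp x (himp y z).
Proof. by apply: le_himp_antisym => t; rewrite !le_himp meetA. Qed.

Lemma himpUl x y z : himp (x `|` y) z = himp x z `&` himp y z.
Proof.
by apply: le_himp_antisym => t; rewrite lexI !le_himp meetUr leUx.
Qed.

End Heyting.

Section AugStone.
Context {d : Order.disp_t} {S : augStoneType d}.
Implicit Types (x y : S) (c b : closed S).

Lemma closed_valU_compl c : val c `|` val (~` c) = \top.
Proof. exact: (congr1 val (joinxC c)). Qed.

Lemma closed_valI_compl c : val c `&` val (~` c) = \bot.
Proof. exact: (congr1 val (meetxC c)). Qed.

(** A closed [c] is complemented by its pseudocomplement, since the Stone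
    identity reads [~ c \/ c = 1] when [~~ c = c]; implication out of a
    complemented element is the Boolean one. *)
Lemma himp_closed c x : himp (val c) x = val (~` c) `|` x.
Proof.
apply/le_anti/andP; split; last first.
  by rewrite le_himp meetUl [_ `&` val c]meetC closed_valI_compl join0x leIl.
rewrite -[leLHS]meetx1 -(closed_valU_compl c) meetUr leUx.
rewrite (le_trans (leIr _ _) (leUl _ _)) andbT.
by apply: le_trans (leUr _ _); rewrite -le_himp.
Qed.

(** Density of [e]: [~~ e] is [e -> e]. *)
Lemma clos_closure_elt : clos (closure_elt : S) = \top.
Proof. by rewrite /clos -closure_eltE himpxx. Qed.

Lemma hneg_closure_elt : hneg (closure_elt : S) = \bot.
Proof. by rewrite -hneg_closed -[LHS]/(hneg (clos _)) clos_closure_elt hneg_top. Qed.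

(** The premise [e] takes the closure of the conclusion; double negation
    distributes over meets and joins in a Stone algebra and sends [x \/ e]
    to [1]. *)
Lemma himp_closure_eltI c x :
  himp closure_elt (val c `&` (x `|` closure_elt)) = val c.
Proof.
rewrite closure_eltE hnegI_stone !hnegU hneg_closure_elt meetx0 hneg_bot meetx1.
by apply/eqP/(valP c).
Qed.

(** The interpretation in [S] of the contract [(c, b)] over the Boolean algebra
    of closed elements of [S]: the counit of the adjunction.  The formula is
    forced, because it expresses a contract through closed ones and [e]. *)
Definition realize c b : S := val b `&` (val (~` c) `|` closure_elt).

(** The modular law for [~ c <= b]. *)
Lemma realizeE c b : c `|` b = \top ->
  realize c b = val (~` c) `|` (val b `&` closure_elt).
Proof.
move=> cb; rewrite /realize meetUr; congr (_ `|` _).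
by apply: (congr1 val (_ : b `&` ~` c = ~` c)); apply/meet_r;
  rewrite -[leLHS]meetx1 -cb meetUr meetCx join0x leIr.
Qed.

Lemma realize_meet c b c' b' :
  realize (c `|` c') (b `&` b') = realize c b `&` realize c' b'.
Proof. by rewrite /realize complU /= joinIl meetACA. Qed.

Lemma realize_join c b c' b' : c `|` b = \top -> c' `|` b' = \top ->
  realize (c `&` c') (b `|` b') = realize c b `|` realize c' b'.
Proof.
move=> cb cb'; rewrite !realizeE //; first by rewrite complI /= meetUl joinACA.
by rewrite joinIl joinA cb join1x joinCA cb' joinx1 meetx1.
Qed.

(** The premise [b /\ (~ c \/ e)] is eliminated one piece at a time: currying
    isolates the closed [b], the join splits into a closed [~ c] and [e], and
    [himp_closed] and [himp_closure_eltI] evaluate what is left.  Both sides are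
    then lattice polynomials, equal by distributivity and [~ b <= c]; the last
    inequality is where [c \/ b = 1] enters. *)
Lemma realize_imp c b c' b' : c `|` b = \top ->
  realize ((c' `&` ~` c) `|` (b `&` ~` b')) (~` b `|` b') =
  himp (realize c b) (realize c' b').
Proof.
move=> cb; rewrite {2}/realize himpIl himp_closed himpUl himp_closed complK.
rewrite himp_closure_eltI /realize complU !complI !complK /=.
set nb := hneg (val b); set nc' := hneg (val c'); set e := closure_elt.
have nb_c : nb `|` val c = val c.
  apply: (congr1 val (_ : ~` b `|` c = c)); apply/join_r.
  by rewrite -[leLHS]meetx1 -cb meetUr meetCx joinx0 leIr.
have -> : (nb `|` val b') `&` (((nc' `|` val c) `&` (nb `|` val b')) `|` e) =
          (nb `|` val b') `&` (val c `|` (nc' `|` e)).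
  by rewrite meetUr meetCA meetxx meetC -meetUr [nc' `|` _]joinC joinA.
have -> : (val c `|` (val b' `&` (nc' `|` e))) `&` val b' =
          val b' `&` (val c `|` (nc' `|` e)).
  by rewrite meetC !meetUr !meetA meetxx.
by rewrite joinIr [nb `|` (val c `|` _)]joinA nb_c.
Qed.

Lemma realize_top : realize \bot \top = \top.
Proof. by rewrite /realize compl0 meet1x join1x. Qed.

Lemma realize_bot : realize \top \bot = \bot.
Proof. by rewrite /realize meet0x. Qed.

Lemma realize_e : realize \top \top = closure_elt.
Proof. by rewrite /realize compl1 meet1x join0x. Qed.

Lemma realize_closed b : realize (~` b) b = val b.
Proof. by rewrite /realize complK joinKI. Qed.

End AugStone.

Section Adjunction.
Context {d : Order.disp_t}.
Implicit Types (B : ctbDistrLatticeType d) (S : augStoneType d).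

Fact closed_contract_subproof B (b : B) : ~` b `|` b == \top.
Proof. by rewrite joinCx. Qed.

Definition closed_contract B (b : B) : contract B :=
  @Contract d B (~` b, b) (closed_contract_subproof b).

Fact closed_contract_closed B (b : B) : is_closed (closed_contract b).
Proof. by apply/eqP/val_inj; rewrite [LHS]contract_hnegE contract_hnegE /= complK. Qed.

Definition adj_unit_fun B (b : B) : closed (contract B) :=
  Closed (closed_contract_closed b).

Fact adj_unit_subproof B : is_bool_hom (@adj_unit_fun B).
Proof.
split=> *; do 2!apply: val_inj.
- by rewrite /= complI.
- by rewrite /= complU.
- by rewrite [RHS]contract_hnegE /= complK.
- by rewrite /= compl1.
- by rewrite /= compl0.
Qed.

Definition adj_unit B : bool_hom B (closed (contract B)) :=
  BoolHom (adj_unit_subproof B).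

(** The closed contracts together with [e] generate [contract B]; the
    assumption [a] is recovered as [~ g \/ a], because [~ g <= a]. *)
Lemma contract_decomp B (x : contract B) :
  x = realize (adj_unit B (contract_val x).1) (adj_unit B (contract_val x).2).
Proof.
rewrite /realize -(bool_homC (bool_funP (adj_unit B))).
apply: val_inj; rewrite /= complK meetx1 joinx1 meetx1 (join_r _); first by case: (contract_val x).
by rewrite -[leLHS]meetx1 -(asm_gua x) meetUr meetCx joinx0 leIr.
Qed.

Section Mate.
Context (B : ctbDistrLatticeType d) (S : augStoneType d)
        (h : bool_hom B (closed S)).

Definition mate_fun (x : contract B) : S :=
  realize (h (contract_val x).1) (h (contract_val x).2).

Fact mate_subproof : is_aug_hom mate_fun.
Proof.
case: (bool_funP h) => hI hU hC h1 h0.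
have hx (x : contract B) : h (contract_val x).1 `|` h (contract_val x).2 = \top.
  by rewrite -hU asm_gua.
split=> [x y|x y|x y|||]; rewrite /mate_fun /= ?(hI, hU, hC, h1, h0).
- exact: realize_meet.
- exact: realize_join.
- exact: realize_imp.
- exact: realize_top.
- exact: realize_bot.
- exact: realize_e.
Qed.

Definition mate : aug_hom (contract B) S := AugHom mate_subproof.

End Mate.

Lemma aug_hom_realize S S' (f : aug_hom S S') (c b : closed S) :
  f (realize c b) = realize (clos_fun f c) (clos_fun f b).
Proof.
case: (aug_funP f) => fI fU _ _ _ fe.
by rewrite /realize fI fU fe /= aug_hom_hneg.
Qed.

Lemma mateK B S (h : bool_hom B (closed S)) :
  bool_comp (clos_hom (mate h)) (adj_unit B) = h.
Proof.
apply: bool_hom_ext => b; apply: val_inj => /=.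
by rewrite /mate_fun /= (bool_homC (bool_funP h)) realize_closed.
Qed.

(** Uniqueness of the extension: by [contract_decomp], [f] is known once its
    values on closed contracts are. *)
Lemma mate_transpose B S (f : aug_hom (contract B) S) :
  mate (bool_comp (clos_hom f) (adj_unit B)) = f.
Proof.
apply: aug_hom_ext => x.
by rewrite [in RHS](contract_decomp x) aug_hom_realize.
Qed.

End Adjunction.

Theorem theorem3p4 (d : Order.disp_t) :
  left_adjoint (ContractFunctor d) (ClosFunctor d).
Proof.
exists (fun (B : ob (BoolCat d)) (S : ob (AugStoneCat d))
          (f : hom (ContractFunctor d B) S) =>
          bool_comp (clos_hom f) (adj_unit B)).
split=> [B S | B B' S u f | B S S' v f].
- exists (@mate d B S); [exact: mate_transpose | exact: mateK].
- apply: bool_hom_ext => b; apply: val_inj => /=.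
  (* [u] commutes with complements, so it sends [(~ b, b)] to [(~ u b, u b)]. *)
  by congr (aug_fun f _); apply: val_inj; rewrite /= (bool_homC (bool_funP u)).
- by apply: bool_hom_ext => b; apply: val_inj.
Qed.
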